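(* For every integer $k\ge 1$ there exists a value $D=D(k)$ such that every $3$-edge-connected simple graph with tree-cut width at most $k$ has maximum degree at most $D$ and tree-width at most $D$.
   Context: A tree-cut decomposition of $G$ is a pair $(T,\mathcal X)$ where $T$ is a tree and $\mathcal X=\{X_t: t\in V(T)\}$ is a family of pairwise disjoint, possibly empty, subsets of $V(G)$ with union $V(G)$. For $X\subseteq V(G)$, $\delta(X)$ is the set of edges with exactly one end in $X$. For an edge $uv$ of $T$, let $T_v$ be the component of $T-uv$ containing $v$; the adhesion is $\max_{uv\in E(T)}|\delta(\bigcup_{t\in V(T_v)}X_t)|$ (or $0$ if $T$ has no edges). Consolidating a vertex set means deleting all edges with both ends in it and identifying it to a single vertex. The torso at $t$ is $G$ if $|V(T)|=1$, and otherwise is obtained from $G$ by consolidating, for each component $T_i$ of $T-t$, the set $\bigcup_{x\in V(T_i)}X_x$ to a single vertex. For a $3$-edge-connected graph, the width of $(T,\mathcal X)$ is the maximum of the adhesion and the numbers of vertices of the torsos; the tree-cut width is the minimum width over all tree-cut decompositions. *)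

(* Defs.v *)
From mathcomp Require Import all_boot.
From mathcomp Require Import boolp.

Set Implicit Arguments.
Unset Strict Implicit.
Unset Printing Implicit Defensive.

(** Finite multigraphs, loops allowed: an edge has one end if it is a loop and
    two ends otherwise. Multigraphs are needed because torsos of simple graphs
    may have parallel edges. *)
Record mgraph := MGraph {
  vertex : finType;
  edge : finType;
  ends : edge -> {set vertex};
  card_ends : forall e, 0 < #|ends e| <= 2
}.

Section Graphs.
Variable G : mgraph.
Implicit Types (X A : {set vertex G}) (F : {set edge G}) (u v : vertex G).

Definition simple : Prop :=
  (forall e : edge G, #|ends e| = 2) /\ injective (@ends G).

(** Adjacency in the subgraph with vertex set [A] whose edges are the members
    of [F] with all ends in [A]. *)
Definition adj_in A F : rel (vertex G) :=
  fun u v => [&& u \in A, v \in A & [exists e in F, ends e == [set u; v]]].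

Definition adj : rel (vertex G) := adj_in setT setT.

Definition connected_in A F : Prop :=
  A != set0 /\ {in A &, forall u v, connect (adj_in A F) u v}.

Definition connected : Prop := connected_in setT setT.

(** The vertex set of the component containing [v], for [v] in [A]. *)
Definition component A F v : {set vertex G} := [set u | connect (adj_in A F) v u].

Definition edge_connected (n : nat) : Prop :=
  forall F, #|F| < n -> connected_in setT (~: F).

(** [ucycle] also holds of the sequence of the two ends of an edge, hence the
    bound on the length. *)
Definition acyclic : Prop :=
  forall c : seq (vertex G), 2 < size c -> ~ ucycle adj c.

Definition is_tree : Prop := [/\ simple, connected & acyclic].

Definition delta X : {set edge G} :=
  [set e | (ends e :&: X != set0) && ~~ (ends e \subset X)].

(** A loop contributes 2 to the degree. *)
Definition degree v : nat :=
  \sum_(e : edge G | v \in ends e) (if #|ends e| == 1 then 2 else 1).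

Definition max_degree : nat := \max_(v : vertex G) degree v.

End Graphs.

(** Simultaneous consolidation of the members of a family [P] of pairwise
    disjoint vertex sets. The new vertices are the classes of the equivalence
    relation "equal, or in a common member of [P]"; in particular an empty
    member of [P] contributes no vertex. *)
Section Consolidation.
Variables (G : mgraph) (P : {set {set vertex G}}).

Definition cons_class (u : vertex G) : {set vertex G} :=
  [set v | (u == v) || [exists Z in P, (u \in Z) && (v \in Z)]].

Definition cons_vertex : finType :=
  {B : {set vertex G} | B \in [set cons_class u | u : vertex G]}.

Lemma cons_classP (u : vertex G) :
  cons_class u \in [set cons_class v | v : vertex G].
Proof. exact: imset_f. Qed.

Definition cons_proj (u : vertex G) : cons_vertex :=
  exist _ (cons_class u) (cons_classP u).

Definition cons_edge : finType :=
  {e : edge G | ~~ [exists Z in P, ends e \subset Z]}.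

Definition cons_ends (e : cons_edge) : {set cons_vertex} :=
  [set cons_proj u | u in ends (val e)].

Lemma card_cons_ends (e : cons_edge) : 0 < #|cons_ends e| <= 2.
Proof.
have /andP[h0 h2] := card_ends (val e).
rewrite (leq_trans (leq_imset_card _ _) h2) andbT.
by move: h0; rewrite !card_gt0 imset_eq0.
Qed.

Definition consolidate : mgraph := MGraph card_cons_ends.

End Consolidation.

Record tree_cut_decomposition (G : mgraph) := TreeCutDecomposition {
  tcd_tree : mgraph;
  tcd_is_tree : is_tree tcd_tree;
  tcd_bag : vertex tcd_tree -> {set vertex G};
  tcd_disjoint : forall s t, s != t -> [disjoint tcd_bag s & tcd_bag t];
  tcd_cover : \bigcup_t tcd_bag t = setT
}.

Section TreeCutWidth.
Variables (G : mgraph) (D : tree_cut_decomposition G).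
Let T := tcd_tree D.

Definition bags_union (S : {set vertex T}) : {set vertex G} :=
  \bigcup_(t in S) tcd_bag t.

(** [component setT (~: [set f]) v] is the component of [T - f] containing
    [v]. *)
Definition adhesion : nat :=
  \max_(f : edge T) \max_(v in ends f)
    #|delta (bags_union (component setT (~: [set f]) v))|.

Definition components_minus (t : vertex T) : {set {set vertex T}} :=
  [set component [set~ t] setT s | s in [set~ t]].

Definition torso (t : vertex T) : mgraph :=
  if #|vertex T| == 1 then G
  else consolidate [set bags_union C | C in components_minus t].

(** This is the appropriate notion of width when [G] is 3-edge-connected; in
    general the torsos have to be replaced by their 3-centers. *)
Definition tcd_width : nat :=
  maxn adhesion (\max_(t : vertex T) #|vertex (torso t)|).

End TreeCutWidth.

Record tree_decomposition (G : mgraph) := TreeDecomposition {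
  td_tree : mgraph;
  td_is_tree : is_tree td_tree;
  td_bag : vertex td_tree -> {set vertex G};
  td_edge : forall e : edge G, exists t, ends e \subset td_bag t;
  td_vertex : forall v : vertex G, connected_in [set t | v \in td_bag t] setT
}.

(** The truncated predecessor only matters for the graph with no vertices. *)
Definition td_width (G : mgraph) (D : tree_decomposition G) : nat :=
  (\max_(t : vertex (td_tree D)) #|td_bag t|).-1.

(** The one-vertex decompositions, showing that the minima below are taken over
    nonempty sets. *)
Lemma void_ends_card (e : void) :
  0 < #|(fun x : void => match x with end : {set unit}) e| <= 2.
Proof. by case: e. Qed.

Definition point : mgraph := MGraph void_ends_card.

Lemma point_is_tree : is_tree point.
Proof.
split.
- by split=> -[].
- split; first by apply/set0Pn; exists tt; rewrite inE.
  by move=> [] [] _ _; apply: connect0.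
- move=> c szc /andP[_ /card_uniqP uc].
  have := max_card (mem c); rewrite uc card_unit => h.
  by have := leq_trans szc h.
Qed.

Section Trivial.
Variable G : mgraph.

Lemma trivial_disjoint (s t : vertex point) :
  s != t -> [disjoint [set: vertex G] & [set: vertex G]].
Proof. by case: s; case: t; rewrite eqxx. Qed.

Lemma trivial_cover : \bigcup_(t : vertex point) [set: vertex G] = setT.
Proof. by apply/setP=> x; rewrite inE; apply/bigcupP; exists tt. Qed.

Definition trivial_tcd : tree_cut_decomposition G :=
  TreeCutDecomposition point_is_tree trivial_disjoint trivial_cover.

Lemma trivial_td_edge (e : edge G) :
  exists t : vertex point, ends e \subset [set: vertex G].
Proof. by exists tt; apply: subsetT. Qed.

Lemma trivial_td_vertex (v : vertex G) :
  connected_in [set t : vertex point | v \in [set: vertex G]] setT.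
Proof.
split; first by apply/set0Pn; exists tt; rewrite !inE.
by move=> [] [] _ _; apply: connect0.
Qed.

Definition trivial_td : tree_decomposition G :=
  TreeDecomposition point_is_tree trivial_td_edge trivial_td_vertex.

Lemma ex_tcd_width :
  exists n, `[< exists D : tree_cut_decomposition G, tcd_width D = n >].
Proof. by exists (tcd_width trivial_tcd); apply/asboolP; exists trivial_tcd. Qed.

Lemma ex_td_width :
  exists n, `[< exists D : tree_decomposition G, td_width D = n >].
Proof. by exists (td_width trivial_td); apply/asboolP; exists trivial_td. Qed.

Definition tree_cut_width : nat := ex_minn ex_tcd_width.
Definition tree_width : nat := ex_minn ex_td_width.

End Trivial.

(* Main.v *)
Require Import Defs.
From mathcomp Require Import all_boot.

Set Implicit Arguments.
Unset Strict Implicit.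
Unset Printing Implicit Defensive.

(** Say that an edge of [G] crosses a node [t] of a tree-cut decomposition if it
    leaves the union of the bags over some component of [T - t]. At most [k]
    such unions are nonempty, since each is a vertex of the torso, and each is
    left by at most [k] edges, since the component is also a component of
    [T - f] for the edge [f] joining it to [t]. Adding to the bag at [t] the
    ends of the at most [k ^ 2] edges crossing [t] yields a set of at most
    [k + 2 k ^ 2] vertices which contains all neighbours of the original bag.
    The enlarged bags form a tree-decomposition over the same tree, because an
    edge with ends in the bags at [s] and [r] crosses exactly the nodes of the
    path from [s] to [r]. *)

(** * Cardinality of finite unions *)

Lemma card_bigcup_le (I J : finType) (A : {set I}) (F : I -> {set J}) m :
  (forall i, i \in A -> #|F i| <= m) -> #|\bigcup_(i in A) F i| <= #|A| * m.
Proof.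
move=> Fm; rewrite -sum_nat_const.
apply: (@leq_trans (\sum_(i in A) #|F i|)); last exact: leq_sum.
apply: (big_ind2 (fun (X : {set J}) n => #|X| <= n)) => [|X m1 Y m2 Xm Ym|//].
  by rewrite cards0.
exact: leq_trans (leq_card_setU X Y) (leq_add Xm Ym).
Qed.

(** * Connectivity and separation in trees *)

Section AdjIn.
Variable G : mgraph.
Implicit Types (A B : {set vertex G}) (F H : {set edge G}) (s t x y : vertex G).

Lemma adj_in_sym A F : symmetric (adj_in A F).
Proof. by move=> x y; rewrite /adj_in andbCA setUC. Qed.

Lemma connect_adj_in_sym A F : connect_sym (adj_in A F).
Proof. exact: sym_connect_sym (adj_in_sym A F). Qed.

Lemma adj_in_sub A B F H :
  A \subset B -> F \subset H -> subrel (adj_in A F) (adj_in B H).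
Proof.
move=> /subsetP sAB /subsetP sFH x y /and3P[xA yA /exists_inP[e eF xy]].
by apply/and3P; split; [exact: sAB|exact: sAB|apply/exists_inP; exists e; auto].
Qed.

Lemma path_adj_in_all A F x p : path (adj_in A F) x p -> all [in A] p.
Proof. by elim: p x => //= y p IHp x /andP[/and3P[_ -> _]] /IHp. Qed.

Lemma path_adj_in A x p :
  path (@adj G) x p -> {subset x :: p <= A} -> path (adj_in A setT) x p.
Proof.
elim: p x => //= y p IHp x /andP[/and3P[_ _ xy] /IHp{}IHp] sA.
rewrite {}IHp ?andbT => [|z zp]; last by apply: sA; rewrite inE zp orbT.
by rewrite /adj_in xy !sA ?inE ?eqxx ?orbT.
Qed.

(** [connect] relates every vertex to itself, even one outside [A]; hence the condition [x != y]. *)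
Lemma connect_adj_in_mem A F x y :
  connect (adj_in A F) x y -> x != y -> (x \in A) && (y \in A).
Proof.
case/connectP=> -[|z p] /=; first by move=> _ ->; rewrite eqxx.
move=> /andP[/and3P[-> zA _] /path_adj_in_all pA] -> _ /=.
by apply: (@allP _ [in A] (z :: p)) (mem_last _ _); rewrite /= zA.
Qed.

Lemma connected_uniq_path x y : connected G ->
  exists p, [/\ path (@adj G) x p, uniq (x :: p) & last x p = y].
Proof.
case=> _ /(_ x y (in_setT _) (in_setT _)) /connectP[p xp ->].
by case/shortenP: xp => q xq uq _; exists q.
Qed.

(** Otherwise a path from [x] to [y] avoiding [t] would close up through [t] to a cycle. *)
Lemma acyclic_neighbour_unique t x y : acyclic G -> adj t x -> adj t y ->
  connect (adj_in [set~ t] setT) x y -> x = y.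
Proof.
move=> acG tx ty /connectP[p xp yE]; apply/eqP/negPn/negP => nxy.
case/shortenP: xp yE => q xq uq _ yE.
(* This gives the closed sequence [t, x, q] the third member that [acyclic] demands of a cycle. *)
have q_gt0 : 0 < size q.
  by case: q yE {xq uq} => // /esym/eqP; rewrite (negPf nxy).
have xt : x != t.
  by case: q q_gt0 xq {uq yE} => //= z q _ /andP[/and3P[]]; rewrite !inE.
have tq : t \notin q.
  by apply/negP => /(allP (path_adj_in_all xq)); rewrite !inE eqxx.
apply: (acG [:: t, x & q]) => //.
rewrite /ucycle /cycle rcons_cons /= tx rcons_path -yE.
rewrite (sub_path (adj_in_sub (subsetT _) (subxx _)) xq) [X in X && _]/=.
have -> : adj y t by rewrite /adj adj_in_sym.
by move: uq => /= ->; rewrite inE negb_or eq_sym xt tq.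
Qed.

(** The vertices just before and just after [t] on the path are distinct neighbours of [t]. Joining
    [s] to the end of the path off [t] would connect these neighbours off [t]. *)
Lemma acyclic_path_separates s t p : acyclic G ->
  path (@adj G) s p -> uniq (s :: p) -> t \in p ->
  ~~ connect (adj_in [set~ t] setT) s (last s p).
Proof.
move=> acG + + tp; case/splitPr: p / tp => p1 p2; rewrite last_cat last_cons.
rewrite cat_path => /andP[sp1 /andP[p1t tp2]].
rewrite -cat_cons cat_uniq cons_uniq => /and3P[_ /hasPn dj /andP[tp2N _]].
have tsp1 : t \notin s :: p1 by apply: dj; rewrite inE eqxx.
(* If the path ends in [t], its end lies outside [[set~ t]] and only [t] is connected to it. *)
apply/negP => sr; case: p2 => [|y p2] in tp2 dj tp2N sr *.
  have st : s != t by apply: contraNneq tsp1 => ->; rewrite inE eqxx.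
  by have := connect_adj_in_mem sr st; rewrite !inE eqxx andbF.
have {tp2} /= /andP[ty yp2] := tp2.
have /negP : y \notin s :: p1 by apply: dj; rewrite !inE eqxx orbT.
apply.
suff <- : last s p1 = y by apply: mem_last.
apply: acyclic_neighbour_unique acG _ ty _; first by rewrite /adj adj_in_sym.
have cp1 : connect (adj_in [set~ t] setT) s (last s p1).
  apply/connectP; exists p1 => //; apply: path_adj_in => // z zp.
  by rewrite !inE; apply: contraNneq tsp1 => <-.
have cp2 : connect (adj_in [set~ t] setT) y (last y p2).
  apply/connectP; exists p2 => //; apply: path_adj_in => // z zp.
  by rewrite !inE; apply: contraNneq tp2N => <-.
rewrite connect_adj_in_sym in cp1; rewrite connect_adj_in_sym in cp2.
exact: connect_trans cp1 (connect_trans sr cp2).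
Qed.

(** Take for [f] the last edge of the path from [s] to [t], and for [c] its end other than [t]. *)
Lemma tree_component_minus s t : is_tree G -> s != t ->
  exists f, exists2 c, c \in ends f &
    component [set~ t] setT s = component setT (~: [set f]) c.
Proof.
case=> -[_ injG] cG acG st; have [p [sp up pt]] := connected_uniq_path s t cG.
case/lastP: p sp up pt => [_ _ /eqP|p c']; first by rewrite (negPf st).
rewrite last_rcons => sp up tE; rewrite {c'}tE in sp up.
move: sp; rewrite rcons_path => /andP[sp pt].
have tsp : t \notin s :: p.
  by move: up; rewrite -rcons_cons rcons_uniq => /andP[].
set c := last s p in pt; have /and3P[_ _ /exists_inP[f _ /eqP fE]] := pt.
have sc : connect (adj_in [set~ t] setT) s c.
  apply/connectP; exists p => //; apply: path_adj_in => // z zp.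
  by rewrite !inE; apply: contraNneq tsp => <-.
have ct : c != t by apply: contraNneq tsp => <-; apply: mem_last.
exists f, c; first by rewrite fE !inE eqxx.
apply/setP => x; rewrite !inE (same_connect (connect_adj_in_sym _ _) sc).
apply/idP/idP.
  apply: connect_sub => {}x y xy; apply: connect1.
  case/and3P: xy; rewrite !inE => xt yt /exists_inP[e _ /eqP eE].
  rewrite /adj_in !in_setT /=; apply/exists_inP; exists e; rewrite ?eE //.
  rewrite !inE; apply: contraNneq xt => ef; move/setP/(_ t): fE.
  by rewrite -ef eE !inE eqxx orbT (eq_sym t y) (negPf yt) orbF eq_sym.
(* Conversely, a path from [c] in [T - f] never reaches [t], by induction on the path. *)
case/connectP => q; elim/last_ind: q x => [|q y IHq] x.
  by move=> _ ->; apply: connect0.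
rewrite rcons_path last_rcons => /andP[cq zy] ->{x}.
have {IHq cq} := IHq _ cq erefl; set z := last c q in zy * => cz.
have zt : z != t.
  have [<-//|czN] := eqVneq c z.
  by have := connect_adj_in_mem cz czN; rewrite !inE => /andP[].
case/and3P: zy => _ _ /exists_inP[e]; rewrite !inE => ef /eqP eE.
apply: connect_trans (cz) _.
(* If the next vertex were [t], then [z] and [c] would be neighbours of [t] joined off [t], hence
   equal, and by simplicity the edge used would be [f]. *)
have [yt|yt] := eqVneq y t; last first.
  apply: connect1; rewrite /adj_in !inE zt yt /=.
  by apply/exists_inP; exists e; rewrite ?eE.
have tz : adj t z.
  rewrite /adj adj_in_sym /adj_in !inE /=.
  by apply/exists_inP; exists e; rewrite ?eE ?yt.
have tc : adj t c by rewrite /adj adj_in_sym.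
have cz' : c = z by apply: acyclic_neighbour_unique tc tz cz.
by case/eqP: ef; apply: injG; rewrite eE fE yt cz'.
Qed.

End AdjIn.

(** * Edges and degrees in simple graphs *)

Section SimpleGraph.
Variable G : mgraph.
Hypothesis sG : simple G.

Lemma simple_endsP (e : edge G) v : v \in ends e -> exists w, ends e = [set v; w].
Proof.
have [/(_ e)/eqP/cards2P[x [y [_ ->]]] _] := sG.
by rewrite !inE => /orP[] /eqP->; [exists y|exists x; rewrite setUC].
Qed.

Lemma mem_delta2 (e : edge G) v w X :
  ends e = [set v; w] -> (e \in delta X) = (v \in X) (+) (w \in X).
Proof.
move=> eE; rewrite !inE eE subUset !sub1set setIUl -subset0 subUset !subset0.
have s1 (x : vertex G) : ([set x] :&: X == set0) = (x \notin X).
  by rewrite setI_eq0 disjoints1.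
by rewrite !s1; do 2!case: (_ \in X).
Qed.

(** Without loops and parallel edges, an edge at [v] is determined by its other end. *)
Lemma degree_le_card v (B : {set vertex G}) :
  (forall e : edge G, v \in ends e -> ends e \subset B) -> degree v <= #|B|.
Proof.
have [card2 injG] := sG => sB.
have -> : degree v = #|[set e : edge G | v \in ends e]|.
  rewrite -sum1_card /degree (eq_bigl [in [set e : edge G | v \in ends e]]).
    by apply: eq_bigr => e _; rewrite card2.
  by move=> e; rewrite inE.
rewrite -(card_imset _ injG).
apply: leq_trans (leq_imset_card (fun w => [set v; w]) B).
apply/subset_leq_card/subsetP => _ /imsetP[e + ->]; rewrite inE => ve.
have [w eE] := simple_endsP ve; rewrite eE; apply/imset_f.
by have := sB e ve; rewrite eE subUset !sub1set => /andP[].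
Qed.

End SimpleGraph.

(** * Crossing edges, enlarged bags and their sizes *)

Section EnlargedBags.
Variables (G : mgraph) (D : tree_cut_decomposition G) (k : nat).
Hypotheses (sG : simple G) (Dk : tcd_width D <= k).
Notation T := (tcd_tree D).
Implicit Types (s t r : vertex T) (v w : vertex G) (e : edge G).

Lemma tcd_bag_ex v : exists t : vertex T, v \in tcd_bag t.
Proof.
by have := in_setT v; rewrite -(tcd_cover D) => /bigcupP[t _ vt]; exists t.
Qed.

Lemma mem_bags_union v s (S : {set vertex T}) :
  v \in tcd_bag s -> (v \in bags_union S) = (s \in S).
Proof.
move=> vs; apply/bigcupP/idP => [[t tS vt]|sS]; last by exists s.
have [<-//|ts] := eqVneq t s.
by have /pred0P/(_ v) := tcd_disjoint ts; rewrite /= vt vs.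
Qed.

(** The empty union is discarded because consolidation creates no vertex for it. *)
Definition sides t : {set {set vertex G}} :=
  [set bags_union C | C in components_minus t] :\ set0.

Definition crossing t : {set edge G} := \bigcup_(U in sides t) delta U.

Definition enlarged_bag t : {set vertex G} :=
  tcd_bag t :|: \bigcup_(e in crossing t) ends e.

(** Since the bags partition the vertices, a side contains [v] exactly if its component contains
    [s], and likewise for [w] and [r]. The case where [s] or [r] is [t] is included, as [t] is
    connected only to itself. *)
Lemma mem_crossing e v w s r t :
    ends e = [set v; w] -> v \in tcd_bag s -> w \in tcd_bag r ->
  (e \in crossing t) = ~~ connect (adj_in [set~ t] setT) s r.
Proof.
move=> eE vs wr; apply/bigcupP/idP => [[U]|nsr].
  rewrite inE => /andP[_ /imsetP[_ /imsetP[c _ ->] ->]].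
  rewrite (mem_delta2 _ eE) (mem_bags_union _ vs) (mem_bags_union _ wr) !inE.
  move=> cx; apply: contraL cx => sr; rewrite !(connect_adj_in_sym _ _ c).
  by rewrite (same_connect (connect_adj_in_sym _ _) sr) addbb.
(* A component of [T - t] needs a base point other than [t]; [s] and [r] are not both [t], so the
   ends can be swapped if necessary. *)
wlog st : v w s r eE vs wr nsr / s != t => [hwlog|].
  have [st|] := eqVneq s t; last exact: hwlog eE vs wr nsr.
  apply: (hwlog w v r s) => //; first by rewrite setUC.
    by rewrite connect_adj_in_sym.
  by apply: contraNneq nsr => ->; rewrite st connect0.
exists (bags_union (component [set~ t] setT s)).
  apply/setD1P; split; last by do 2!apply: imset_f; rewrite !inE.
  by apply/set0Pn; exists v; rewrite (mem_bags_union _ vs) !inE.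
rewrite (mem_delta2 _ eE) (mem_bags_union _ vs) (mem_bags_union _ wr) !inE.
by rewrite connect0 (negPf nsr).
Qed.

(** If the other end lies in the bag at some [r != t], the edge crosses [t] by the criterion
    above. *)
Lemma ends_sub_enlarged_bag e v t :
  v \in ends e -> v \in tcd_bag t -> ends e \subset enlarged_bag t.
Proof.
move=> ve vt; have [w eE] := simple_endsP sG ve.
have [r wr] := tcd_bag_ex w; have [rt|rt] := eqVneq r t.
  by rewrite eE subUset !sub1set !inE vt -{2}rt wr.
apply: subset_trans (subsetUr _ _); apply: (bigcup_sup e) => //.
rewrite (mem_crossing _ eE vt wr); apply/negP => /connect_adj_in_mem.
by rewrite eq_sym rt !inE eqxx => /(_ isT).
Qed.

Lemma enlarged_bag_connected v :
  connected_in [set t | v \in enlarged_bag t] setT.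
Proof.
have [_ cT acT] := tcd_is_tree D.
have [s vs] := tcd_bag_ex v.
have sv : s \in [set t | v \in enlarged_bag t] by rewrite !inE vs.
split; first by apply/set0Pn; exists s.
(* It suffices to reach every such node from the node [s] whose original bag contains [v]. *)
suff cs t : t \in [set t | v \in enlarged_bag t] ->
    connect (adj_in [set t | v \in enlarged_bag t] setT) s t.
  by move=> x y /cs + /cs; rewrite connect_adj_in_sym; apply: connect_trans.
rewrite !inE => /orP[vt|/bigcupP[e et ve]].
  suff -> : s = t by apply: connect0.
  by apply/set1P; rewrite -(mem_bags_union _ vs) /bags_union big_set1.
have [w eE] := simple_endsP sG ve; have [r wr] := tcd_bag_ex w.
rewrite (mem_crossing _ eE vs wr) in et.
have [p [sp up pr]] := connected_uniq_path s r cT.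
(* A path from [s] to [r] missing [t] would contradict that [e] crosses [t]. *)
have tp : t \in s :: p.
  apply: contraNT et => tp; apply/connectP; exists p => //.
  by apply: path_adj_in => // z zp; rewrite !inE; apply: contraNneq tp => <-.
apply: path_connect tp; apply: path_adj_in => // x.
rewrite !inE => /orP[/eqP->|xp]; first by rewrite vs.
apply/orP; right; apply/bigcupP; exists e => //.
by rewrite (mem_crossing _ eE vs wr) -pr; apply: acyclic_path_separates.
Qed.

Lemma card_delta_sides t U : U \in sides t -> #|delta U| <= k.
Proof.
rewrite inE => /andP[_ /imsetP[_ /imsetP[s + ->] ->]]; rewrite !inE => st.
have [f [c cf ->]] := tree_component_minus (tcd_is_tree D) st.
apply: leq_trans Dk; apply: leq_trans (leq_maxl _ _).
by apply: (bigmax_sup f) => //; apply: (bigmax_sup c).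
Qed.

Lemma card_torso t : #|vertex (torso t)| <= k.
Proof.
apply: leq_trans Dk; apply: leq_trans (leq_maxr _ _).
exact: (bigmax_sup t).
Qed.

(** Both bounds exhibit distinct torso vertices: the singleton class of each vertex of the bag, and
    each nonempty side, which is itself a class. *)
Lemma torso_bounds t : #|tcd_bag t| <= k /\ #|sides t| <= k.
Proof.
have := card_torso t; rewrite /torso; case: eqP => [T1|_] Gk.
  split; first exact: leq_trans (max_card _) Gk.
  suff -> : sides t = set0 by rewrite cards0.
  apply/setP => U; rewrite !inE.
  apply/negP => /andP[_ /imsetP[_ /imsetP[s + _] _]].
  by rewrite !inE => /negP; apply; apply/eqP/(fintype_le1P _); rewrite T1.
set P := [set bags_union C | C in components_minus t] in Gk.
have {}Gk : #|[set cons_class P u | u : vertex G]| <= k.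
  by move: Gk; rewrite /= card_sig; apply/leq_trans/eq_leq/eq_card.
split; apply: leq_trans Gk.
  rewrite -(card_imset _ (@set1_inj _)); apply/subset_leq_card/subsetP.
  move=> _ /imsetP[u ut ->]; apply/imsetP; exists u => //.
  apply/setP => v; rewrite !inE eq_sym; case: eqP => //= _; symmetry.
  apply/negbTE/exists_inP => -[_ /imsetP[_ /imsetP[s + ->] ->]].
  rewrite !inE (mem_bags_union _ ut) inE => st /andP[/connect_adj_in_mem/(_ st)].
  by rewrite !inE eqxx andbF.
apply/subset_leq_card/subsetP => U /setD1P[/set0Pn[u uU] UP].
apply/imsetP; exists u => //; apply/setP => v; rewrite inE.
apply/idP/idP => [vU|/orP[/eqP<-//|]].
  by apply/orP; right; apply/exists_inP; exists U; rewrite ?uU.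
(* Two sides sharing [u] come from the same component, that of the node whose bag contains [u]. *)
case/exists_inP => V VP /andP[uV vV]; suff -> : U = V by [].
case/imsetP: UP uU => _ /imsetP[s _ ->] ->.
case/imsetP: VP uV => _ /imsetP[s' _ ->] ->.
have [r ur] := tcd_bag_ex u.
rewrite !(mem_bags_union _ ur) !inE => s'r sr; congr bags_union.
apply/setP => x; rewrite !inE (same_connect (connect_adj_in_sym _ _) sr).
by rewrite (same_connect (connect_adj_in_sym _ _) s'r).
Qed.

Lemma card_enlarged_bag t : #|enlarged_bag t| <= k + k * k * 2.
Proof.
have [bk sk] := torso_bounds t.
apply: leq_trans (leq_card_setU _ _) _; apply: leq_add bk _.
apply: (@leq_trans (#|crossing t| * 2)).
  by apply: card_bigcup_le => e _; have [-> _] := sG.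
rewrite leq_mul2r /=; apply: (@leq_trans (#|sides t| * k)).
  exact/card_bigcup_le/card_delta_sides.
by rewrite leq_mul2r sk orbT.
Qed.

Lemma max_degree_bound : max_degree G <= k + k * k * 2.
Proof.
apply/bigmax_leqP => v _; have [t vt] := tcd_bag_ex v.
apply: leq_trans (card_enlarged_bag t); apply: (degree_le_card sG) => e ve.
exact: ends_sub_enlarged_bag ve vt.
Qed.

Lemma enlarged_bag_edge e : exists t, ends e \subset enlarged_bag t.
Proof.
have /andP[/card_gt0P[v ve] _] := card_ends e; have [t vt] := tcd_bag_ex v.
by exists t; apply: ends_sub_enlarged_bag ve vt.
Qed.

Definition enlarged_td : tree_decomposition G :=
  TreeDecomposition (tcd_is_tree D) enlarged_bag_edge enlarged_bag_connected.

Lemma tree_width_bound : tree_width G <= k + k * k * 2.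
Proof.
rewrite /tree_width; case: ex_minnP => m _ min_m.
apply: (@leq_trans (td_width enlarged_td)).
  by apply/min_m/boolp.asboolP; exists enlarged_td.
apply: leq_trans (leq_pred _) _; apply/bigmax_leqP => t _.
exact: card_enlarged_bag.
Qed.

End EnlargedBags.

Theorem theorem6 (k : nat) (hk : 1 <= k) :
  exists D : nat, forall G : mgraph,
    simple G -> edge_connected G 3 -> tree_cut_width G <= k ->
    max_degree G <= D /\ tree_width G <= D.
Proof.
(* This bounds the enlarged bags, which are the bags of the tree-decomposition and contain the
   neighbourhood of each vertex of the original bag. *)
exists (k + k * k * 2) => G sG _; rewrite /tree_cut_width.
case: ex_minnP => m /boolp.asboolP[D <-] _ Dk; split.
  exact: max_degree_bound sG Dk.
exact: tree_width_bound sG Dk.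
Qed.
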